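(* Let $(\Omega,\mathcal{A})$ be a standard Borel space with probability measure $\mu$. If $A$ is a graphop on $(\Omega,\mathcal{A},\mu)$, then there is a unique finite measure $\nu$ on $(\Omega\times\Omega,\mathcal{A}\otimes\mathcal{A})$ such that: (1) $\nu$ is symmetric, i.e. $\nu(S\times T)=\nu(T\times S)$ for all $S,T\in\mathcal{A}$; (2) the marginal of $\nu$ on $\Omega$ is absolutely continuous with respect to $\mu$; (3) $(f,g)_A=\int_{\Omega^2}f(x)g(y)\,d\nu(x,y)$ for all $f,g\in L^\infty(\Omega)$. Conversely, if $\nu$ is a finite measure on $(\Omega\times\Omega,\mathcal{A}\otimes\mathcal{A})$ satisfying (1) and (2), then there is a unique graphop $A$ on $(\Omega,\mathcal{A},\mu)$ satisfying (3).
   Context: A $P$-operator on a probability space $(\Omega,\mathcal{A},\mu)$ is a linear map $A:L^\infty(\Omega)\to L^1(\Omega)$, $v\mapsto vA$, with $\sup_v\|vA\|_1/\|v\|_\infty<\infty$. Define $(f,g)_A:=\int_\Omega (fA)g\,d\mu$. $A$ is self-adjoint if $(v,w)_A=(w,v)_A$ for all $v,w\in L^\infty(\Omega)$, and positivity-preserving if $v\ge0$ a.e. implies $vA\ge0$ a.e. A graphop is a self-adjoint, positivity-preserving $P$-operator. *)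

(* Defs.v *)
From HB Require Import structures.
From mathcomp Require Import all_boot all_order all_algebra.
From mathcomp Require Import all_classical all_reals all_analysis.

Set Implicit Arguments.
Unset Strict Implicit.
Unset Printing Implicit Defensive.
Import Order.TTheory GRing.Theory Num.Theory.
Import numFieldNormedType.Exports.

Local Open Scope classical_set_scope.
Local Open Scope ring_scope.

(** Standard Borel space: measurably isomorphic to a Borel subset of the real
    line (Kuratowski's characterisation of standard Borel spaces). *)
Definition standard_borel d (T : measurableType d) (R : realType) : Prop :=
  exists (B : set (measurableTypeR R)) (phi : T -> measurableTypeR R),
    [/\ measurable B,
        measurable_fun setT phi,
        injective phi,
        phi @` setT = B
      & forall E, measurable E -> measurable (phi @` E)].

Section Pop.
Context d (T : measurableType d) (R : realType).
Variable mu : {measure set T -> \bar R}.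

Definition Linf (f : T -> R) : Prop :=
  measurable_fun setT f /\ ('N[mu]_(+oo%E)[EFin \o f] < +oo)%E.

Definition L1 (h : T -> R) : Prop := mu.-integrable setT (EFin \o h).

(** A P-operator: a bounded linear map L^oo -> L^1, given on representatives
    (v |-> vA is written A v); well defined on a.e.-classes. *)
Definition P_operator (A : (T -> R) -> (T -> R)) : Prop :=
  [/\ (forall v, Linf v -> L1 (A v)),
      (forall v w, Linf v -> Linf w -> ae_eq mu setT v w ->
          ae_eq mu setT (A v) (A w)),
      (forall (a : R) v w, Linf v -> Linf w ->
          ae_eq mu setT (A (fun x => a * v x + w x))
                        (fun x => a * A v x + A w x))
    & exists C : R, forall v, Linf v ->
          ('N[mu]_1[EFin \o A v] <= C%:E * 'N[mu]_(+oo%E)[EFin \o v])%E].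

Definition pairA (A : (T -> R) -> (T -> R)) (f g : T -> R) : \bar R :=
  (\int[mu]_x (A f x * g x)%:E)%E.

Definition self_adjoint (A : (T -> R) -> (T -> R)) : Prop :=
  forall v w, Linf v -> Linf w -> pairA A v w = pairA A w v.

Definition positivity_preserving (A : (T -> R) -> (T -> R)) : Prop :=
  forall v, Linf v -> (\forall x \ae mu, 0 <= v x) ->
    (\forall x \ae mu, 0 <= A v x).

Definition graphop (A : (T -> R) -> (T -> R)) : Prop :=
  [/\ P_operator A, self_adjoint A & positivity_preserving A].

Definition symmetric_measure (nu : set (T * T) -> \bar R) : Prop :=
  forall S U : set T, measurable S -> measurable U ->
    nu (S `*` U) = nu (U `*` S).

Definition marginal_ac (nu : set (T * T) -> \bar R) : Prop :=
  pushforward nu fst `<< mu.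

Definition represents (A : (T -> R) -> (T -> R)) (nu : set (T * T) -> \bar R)
  : Prop :=
  forall f g, Linf f -> Linf g ->
    pairA A f g = (\int[nu]_z (f z.1 * g z.2)%:E)%E.

End Pop.

(* Main.v *)
(**
A bounded functional on L^oo that vanishes on indicators is zero, so the
bilinear form of a graphop and the integral against [nu] agree as soon as they
agree on rectangles; uniqueness of [nu] and of [A] follows at once.

From [nu] to [A]: [f A] is the Radon-Nikodym derivative of the charge
[E |-> \int_(Omega * E) f(x) dnu(x, y)]; testing against the sign of [f A]
bounds its L^1 norm by [nu(Omega^2) * ||f||_oo].

From [A] to [nu]: self-adjointness gives
[\int_U 1_S A dmu = \int_S 1_U A dmu], so that [(1_S, 1_U)_A] is countably
additive in each variable. To extend it from rectangles to a measure, choose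
measurable [phi : Omega -> ]0, +oo[] and [psi] with [psi \o phi = id], and let
[F_q = 1_(phi < q) A] for rational [q >= 0]. With
[Q(x, t) = inf {q | t <= F_q(x)}], the measure [nu] is the image of
[mu \x lebesgue], restricted to the region under the [F_q], by
[(x, t) |-> (psi (Q(x, t)), x)]. The section of [{Q < r}] at almost every [x]
lies between [`]0, F_q(x)]] (for any [q < r]) and [`]0, (1_(phi < r) A)(x)]],
whence [nu({phi < r} * U) = (1_(phi < r), 1_U)_A], and a pi-system argument
gives all rectangles.
*)
Require Import Defs.
From HB Require Import structures.
From mathcomp Require Import all_boot all_order all_algebra.
From mathcomp Require Import all_classical all_reals all_analysis.
From mathcomp Require Import measurable_realfun ess_sup_inf ring lra.

Set Implicit Arguments.
Unset Strict Implicit.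
Unset Printing Implicit Defensive.
Import Order.TTheory GRing.Theory Num.Theory.
Import numFieldNormedType.Exports.
Local Open Scope classical_set_scope.
Local Open Scope ring_scope.

(** * Essentially bounded functions, and integrable functions tested on indicators *)

Section essentially_bounded.
Context d (T : measurableType d) (R : realType) (mu : probability T R).
Implicit Types (f g h : T -> R) (M : R).

Lemma Lnorm_oo_leP f M :
  ('N[mu]_(+oo%E)[EFin \o f] <= M%:E)%E <-> (\forall x \ae mu, `|f x| <= M).
Proof.
(* On a null space the norm is zero by convention; mass one makes it the essential supremum. *)
rewrite unlock ifT; last by rewrite [ltRHS]probability_setT lte01.
split.
  by move/ess_supP; apply: filterS => x /=; rewrite lee_fin.
by move=> fM; apply/ess_supP; apply: filterS fM => x /=; rewrite lee_fin.
Qed.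

Lemma LinfP f :
  Linf mu f <-> measurable_fun setT f /\ exists M, \forall x \ae mu, `|f x| <= M.
Proof.
split=> [[mf fi]|[mf [M fM]]]; split => //.
  exists (fine ('N[mu]_(+oo%E)[EFin \o f])%E); apply/Lnorm_oo_leP.
  by rewrite fineK// ge0_fin_numE// Lnorm_ge0.
by move/Lnorm_oo_leP : fM => /le_lt_trans; apply; rewrite ltry.
Qed.

Lemma ae_bound_ge0 f M : (\forall x \ae mu, `|f x| <= M) -> 0 <= M.
Proof. by move/Lnorm_oo_leP/(le_trans (Lnorm_ge0 _ _ _)); rewrite lee_fin. Qed.

Lemma Linf_indic (E : set T) : measurable E -> Linf mu (\1_E : T -> R).
Proof.
move=> mE; apply/LinfP; split; first exact: measurable_indic.
exists 1; apply: aeW => x; rewrite indicE.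
by case: (x \in E); rewrite ?normr1// normr0.
Qed.

Lemma Linf_lin (a : R) f g :
  Linf mu f -> Linf mu g -> Linf mu (fun x => a * f x + g x).
Proof.
move=> /LinfP[mf [M fM]] /LinfP[mg [N gN]]; apply/LinfP; split.
  by apply: measurable_funD => //; exact: measurable_funM.
exists (`|a| * M + N); apply: filterS2 fM gN => x fM gN.
by rewrite (le_trans (ler_normD _ _))// lerD// normrM ler_wpM2l.
Qed.

(* Halving: subtracting [M/2 * sign f] from [f], which does not change
   the value of the functional, divides the essential bound by two. *)
Lemma Linf_functional_eq0 (L : (T -> R) -> R) (C : R) :
  (forall a f g, Linf mu f -> Linf mu g ->
     L (fun x => a * f x + g x) = a * L f + L g) ->
  (forall f M, Linf mu f -> (\forall x \ae mu, `|f x| <= M) ->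
     `|L f| <= C * M) ->
  (forall E, measurable E -> L \1_E = 0) ->
  forall f, Linf mu f -> L f = 0.
Proof.
move=> lin bnd ind.
have step n : forall f M, Linf mu f -> (\forall x \ae mu, `|f x| <= M) ->
    `|L f| <= C * (M / 2 ^+ n).
  elim: n => [|n IH] f M If fM; first by rewrite expr0 divr1 bnd.
  have mE : measurable [set x | 0 <= f x].
    rewrite -[X in measurable X]setTI.
    by have [mf _] := If; rewrite -preimage_itvcy; exact: mf.
  have I1 := Linf_indic mE.
  have IT := Linf_indic (@measurableT _ T).
  (* The sign of [f] is written as a combination of indicators, on which [L] vanishes. *)
  pose g x := M / 2 * \1_setT x + (- M * \1_[set x | 0 <= f x] x + f x).
  have Ig : Linf mu g by apply: Linf_lin => //; exact: Linf_lin.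
  have -> : L f = L g.
    rewrite /g lin//; last exact: Linf_lin.
    by rewrite lin// !ind// !mulr0 !add0r.
  have -> : M / 2 ^+ n.+1 = M / 2 / 2 ^+ n by rewrite exprS invfM mulrA.
  apply: IH => //.
  apply: filterS fM => x; rewrite /g indicT mulr1 indicE.
  have [fx|fx] := leP 0 (f x).
    by rewrite mem_set//= ger0_norm// ler_norml => ?; lra.
  rewrite memNset/=; last by apply/negP; rewrite -ltNge.
  by rewrite ltr0_norm// ler_norml => ?; lra.
move=> f If; have /LinfP[_ [M fM]] := If.
have M0 := ae_bound_ge0 fM.
apply/eqP; rewrite -normr_eq0 eq_le normr_ge0 andbT leNgt; apply/negP => L0.
(* With [n + 1] above this ratio, the bound of [step] would give [2 ^ (n + 1) < n + 1]. *)
pose n := Num.truncn (C * M / `|L f|).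
have : C * M / `|L f| < n.+1%:R by rewrite truncnS_gt.
rewrite ltr_pdivrMr//.
have := step n.+1 f M If fM.
rewrite mulrA ler_pdivlMr ?exprn_gt0//.
move=> le1 lt1; have := le_lt_trans le1 lt1.
rewrite mulrC ltr_pM2r//; apply/negP; rewrite -leNgt.
by rewrite -natrX ler_nat ltnW// ltn_expl.
Qed.

(** Hoelder's inequality for the exponents one and infinity, with any essential bound [M] of [g] in
    place of its norm. *)
Lemma L1_mulr h g M : L1 mu h -> Linf mu g -> (\forall x \ae mu, `|g x| <= M) ->
  mu.-integrable setT (fun x => (h x * g x)%:E) /\
  (`|\int[mu]_x (h x * g x)%:E| <= 'N[mu]_1[EFin \o h] * M%:E)%E.
Proof.
move=> h1 [mg _] gM.
have mh : measurable_fun setT h by apply/measurable_EFinP; exact: measurable_int h1.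
have M0 := ae_bound_ge0 gM.
have le : (\int[mu]_x `|(h x * g x)%:E| <= 'N[mu]_1[EFin \o h] * M%:E)%E.
  rewrite Lnorm1 -ge0_integralZr//.
  - apply: ae_ge0_le_integral => //.
    + by apply/measurable_EFinP; apply: measurableT_comp => //; exact: measurable_funM.
    + by move=> x _; rewrite mule_ge0.
    + apply: emeasurable_funM => //; apply: measurableT_comp => //.
      exact/measurable_EFinP.
    + apply: filterS gM => x gM _ /=.
      by rewrite -EFinM lee_fin normrM ler_wpM2l.
  - by apply: measurableT_comp => //; exact/measurable_EFinP.
  have mhg : measurable_fun setT (fun x => (h x * g x)%:E).
  by apply/measurable_EFinP; exact: measurable_funM.
split.
  apply/integrableP; split => //; apply: (le_lt_trans le).
  move/integrableP : h1 => [_]; rewrite Lnorm1 => hoo.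
  have n0 : (0 <= \int[mu]_x `|(EFin \o h) x|)%E by exact: integral_ge0.
  by apply: lte_mul_pinfty => //; [rewrite ge0_fin_numE|rewrite ltry].
by apply: le_trans le; exact: le_abse_integral.
Qed.

Lemma L1_mulr_integrable h g : L1 mu h -> Linf mu g ->
  mu.-integrable setT (fun x => (h x * g x)%:E).
Proof.
move=> h1 ig; have /LinfP[_ [M gM]] := ig.
by have [] := L1_mulr h1 ig gM.
Qed.

Lemma integral_mul_indic (h : T -> R) (E : set T) : measurable E ->
  (\int[mu]_x (h x * \1_E x)%:E = \int[mu]_(x in E) (h x)%:E)%E.
Proof.
move=> mE; rewrite [RHS]integral_mkcond; apply: eq_integral => x _.
by rewrite patchE indicE; case: ifPn => _; rewrite ?mulr1// mulr0.
Qed.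

Lemma L1_ae_eq h1 h2 : L1 mu h1 -> L1 mu h2 ->
  (forall E, measurable E -> \int[mu]_x (h1 x * \1_E x)%:E =
    \int[mu]_x (h2 x * \1_E x)%:E)%E ->
  ae_eq mu setT h1 h2.
Proof.
move=> i1 i2 h12; have : ae_eq mu setT (EFin \o h1) (EFin \o h2).
  apply: integral_ae_eq => //; first exact: measurable_int i2.
  by move=> E _ mE; have := h12 E mE; rewrite !integral_mul_indic.
by apply: filterS => x /(_ I) [].
Qed.

(** Testing on the set where [h] is negative gives [|h|] a vanishing integral there, so that set is
    null. *)
Lemma L1_ge0 h : L1 mu h ->
  (forall E, measurable E -> 0 <= \int[mu]_x (h x * \1_E x)%:E)%E ->
  \forall x \ae mu, 0 <= h x.
Proof.
move=> h1 hE.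
have mh : measurable_fun setT h by apply/measurable_EFinP; exact: measurable_int h1.
have mE : measurable [set x | h x < 0].
  by rewrite -[X in measurable X]setTI -preimage_itvNyo; exact: mh.
have : (\int[mu]_(x in [set x | (h x < 0)%R]) `|(h x)%:E| = 0)%E.
  apply/eqP; rewrite eq_le integral_ge0// andbT -oppe_ge0 -integral_ge0N//.
  have := hE _ mE; rewrite integral_mul_indic//; congr (_ <= _)%E.
  apply: eq_integral => x /set_mem hx /=.
  by rewrite ltr0_norm// opprK.
move/ae_eq_integral_abs => /(_ mE).
have mh' : measurable_fun [set x | h x < 0] (fun x => (h x)%:E).
  by apply/measurable_EFinP; exact: measurable_funTS.
move=> /(_ mh'); apply: filterS => x /= hx; rewrite leNgt; apply/negP => hx0.
by have := hx hx0; case=> hx1; rewrite hx1 ltxx in hx0.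
Qed.

End essentially_bounded.

(** * Images of measures and charges; uniqueness on rectangles *)

Section image_measure.
Context d1 d2 (T1 : measurableType d1) (T2 : measurableType d2).
Context (R : realType) (f : T1 -> T2) (mf : measurable_fun setT f).

Section measure.
Variable m : {measure set T1 -> \bar R}.

(* The measurability proof is an argument of [image_measure], so that the
   measure structure can be inferred, which fails for [pushforward]. *)
Definition image_measure of measurable_fun setT f : set T2 -> \bar R :=
  pushforward m f.

Let nu := image_measure mf.
Let nu0 : nu set0 = 0%E. Proof. exact: measure0. Qed.
Let nu_ge0 A : (0 <= nu A)%E. Proof. exact: measure_ge0. Qed.
Let nu_sigma_additive : semi_sigma_additive nu.
Proof. exact: measure_semi_sigma_additive. Qed.

HB.instance Definition _ :=
  isMeasure.Build _ _ _ (image_measure mf) nu0 nu_ge0 nu_sigma_additive.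

End measure.

Section charge.
Variable m : {charge set T1 -> \bar R}.

Definition image_charge of measurable_fun setT f : set T2 -> \bar R :=
  pushforward m f.

Let nu := image_charge mf.
Let nu0 : nu set0 = 0%E. Proof. exact: charge0. Qed.
Let nu_finite A : measurable A -> nu A \is a fin_num.
Proof. exact: fin_num_measure. Qed.
Let nu_sigma_additive : semi_sigma_additive nu.
Proof. exact: charge_semi_sigma_additive. Qed.

HB.instance Definition _ :=
  isCharge.Build _ _ _ (image_charge mf) nu0 nu_finite nu_sigma_additive.

End charge.

End image_measure.

(** Rectangles form a pi-system that generates the product sigma-algebra and contains the whole
    space, where [nu1] is finite. *)
Lemma measure_rectangles_unique d (T : measurableType d) (R : realType)
    (nu1 nu2 : {measure set (T * T)%type -> \bar R}) :
  (nu1 setT < +oo)%E ->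
  (forall S U, measurable S -> measurable U ->
     nu1 (S `*` U) = nu2 (S `*` U)) ->
  forall E, measurable E -> nu1 E = nu2 E.
Proof.
move=> fin eq12 E mE.
pose G : set (set (T * T)) :=
  [set S `*` U | S in measurable & U in measurable].
apply: (measure_unique G (fun=> setT)) => //.
- exact: measurable_prod_measurableType.
- move=> _ _ [S mS [U mU <-]] [S' mS' [U' mU' <-]]; rewrite -setXI.
  by exists (S `&` S'); [exact: measurableI|exists (U `&` U'); [exact: measurableI|]].
- by move=> _; exists setT => //; exists setT => //; rewrite setXTT.
- by rewrite bigcup_const//; exists 0%N.
- by move=> _ [S mS [U mU <-]]; exact: eq12.
Qed.

(** * Integration of tensor products against a symmetric measure *)

Section symmetric_measure.
Context d (T : measurableType d) (R : realType) (mu : probability T R).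
Variable nu : {finite_measure set (T * T)%type -> \bar R}.
Hypotheses (nu_sym : symmetric_measure nu) (nu_ac : marginal_ac mu nu).
Implicit Types (f g h : T -> R) (M : R).

Let swap (z : T * T) := (z.2, z.1).

Let measurable_swap : measurable_fun setT swap.
Proof. exact: measurable_fun_pair. Qed.

(** Symmetry is given on rectangles only; these determine a finite measure. *)
Lemma symmetric_measure_swap E : measurable E ->
  pushforward nu swap E = nu E.
Proof.
move=> mE; apply/esym; move: E mE.
apply: (@measure_rectangles_unique _ _ _ nu
    (image_measure nu measurable_swap)).
  by rewrite -ge0_fin_numE// fin_num_measure.
move=> S U mS mU; rewrite [LHS]nu_sym// /image_measure /pushforward.
by congr (nu _); apply/seteqP; split=> -[x y] [].
Qed.

Lemma ae_fst (P : set T) : (\forall x \ae mu, P x) -> \forall z \ae nu, P z.1.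
Proof.
move=> [N [mN N0 PN]]; exists (fst @^-1` N); split.
- by rewrite -[X in measurable X]setTI; exact: measurable_fst.
- by move/null_content_dominatesP : nu_ac => /(_ N mN N0).
- by move=> z /= nPz; exact: PN.
Qed.

(** Absolute continuity is assumed of the first marginal; symmetry carries it to the second. *)
Lemma null_snd (N : set T) : measurable N -> mu N = 0 ->
  nu (snd @^-1` N) = 0.
Proof.
move=> mN N0; rewrite -setTX nu_sym// setXT.
by move/null_content_dominatesP : nu_ac => /(_ N mN N0).
Qed.

Lemma ae_snd (P : set T) : (\forall x \ae mu, P x) -> \forall z \ae nu, P z.2.
Proof.
move=> [N [mN N0 PN]]; exists (snd @^-1` N); split.
- by rewrite -[X in measurable X]setTI; exact: measurable_snd.
- exact: null_snd.
- by move=> z /= nPz; exact: PN.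
Qed.

Lemma measurable_tensor f g : measurable_fun setT f -> measurable_fun setT g ->
  measurable_fun setT (fun z : T * T => f z.1 * g z.2).
Proof.
move=> mf mg; apply: measurable_funM.
  exact: measurableT_comp mf measurable_fst.
exact: measurableT_comp mg measurable_snd.
Qed.

Lemma tensor_le f g M N : Linf mu f -> Linf mu g ->
  (\forall x \ae mu, `|f x| <= M) -> (\forall x \ae mu, `|g x| <= N) ->
  nu.-integrable setT (fun z => (f z.1 * g z.2)%:E) /\
  (`|\int[nu]_z (f z.1 * g z.2)%:E| <= (M * N * fine (nu setT))%:E)%E.
Proof.
move=> [mf _] [mg _] fM gN.
have M0 := ae_bound_ge0 fM; have N0 := ae_bound_ge0 gN.
have mfg : measurable_fun setT (fun z : T * T => (f z.1 * g z.2)%:E).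
  by apply/measurable_EFinP; exact: measurable_tensor.
have le : (\int[nu]_z `|(f z.1 * g z.2)%:E| <= (M * N * fine (nu setT))%:E)%E.
  rewrite EFinM fineK ?fin_num_measure// -integral_cst//.
  apply: ae_ge0_le_integral => //.
  - exact: measurableT_comp.
  - by move=> z _; rewrite lee_fin mulr_ge0.
  - apply: filterS2 (ae_fst fM) (ae_snd gN) => z fz gz _.
    by rewrite lee_fin normrM ler_pM.
split; first by apply/integrableP; split => //; rewrite (le_lt_trans le)// ltry.
by apply: le_trans le; exact: le_abse_integral.
Qed.

Lemma tensor_integrable f g : Linf mu f -> Linf mu g ->
  nu.-integrable setT (fun z => (f z.1 * g z.2)%:E).
Proof.
move=> If Ig; have /LinfP[_ [M fM]] := If; have /LinfP[_ [N gN]] := Ig.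
by have [] := tensor_le If Ig fM gN.
Qed.

Lemma tensor_swap f g : Linf mu f -> Linf mu g ->
  (\int[nu]_z (f z.1 * g z.2)%:E = \int[nu]_z (g z.1 * f z.2)%:E)%E.
Proof.
move=> If Ig.
have mgf : measurable_fun setT (fun z : T * T => (g z.1 * f z.2)%:E).
  by apply/measurable_EFinP; apply: measurable_tensor; [case: Ig|case: If].
transitivity (\int[pushforward nu swap]_z (f z.1 * g z.2)%:E)%E.
  apply/esym/eq_measure_integral => E mE _; exact: symmetric_measure_swap.
rewrite integral_pushforward//.
- by apply: eq_integral => z _ /=; rewrite mulrC.
- by apply/measurable_EFinP; apply: measurable_tensor; [case: If|case: Ig].
- apply: eq_integrable (tensor_integrable Ig If) => //.
  by move=> z _ /=; rewrite mulrC.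
Qed.

Lemma tensor_indic (S U : set T) : measurable S -> measurable U ->
  (\int[nu]_z (\1_S z.1 * \1_U z.2)%:E = nu (S `*` U))%E.
Proof.
move=> mS mU; rewrite -[S `*` U]setIT -integral_indic//; last exact: measurableX.
by apply: eq_integral => z _; rewrite !indicE in_setX -mulnb natrM.
Qed.

Lemma eq_tensor_snd f h : Linf mu f -> L1 mu h ->
  (forall E, measurable E ->
    \int[mu]_x (h x * \1_E x)%:E = \int[nu]_z (f z.1 * \1_E z.2)%:E)%E ->
  forall g, Linf mu g ->
    (\int[mu]_x (h x * g x)%:E = \int[nu]_z (f z.1 * g z.2)%:E)%E.
Proof.
move=> If h1 hE g Ig.
have fin_mu g' : Linf mu g' -> (\int[mu]_x (h x * g' x)%:E)%E \is a fin_num.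
  by move=> Ig'; apply: integrable_fin_num => //; exact: L1_mulr_integrable.
have fin_nu g' : Linf mu g' ->
    (\int[nu]_z (f z.1 * g' z.2)%:E)%E \is a fin_num.
  by move=> Ig'; apply: integrable_fin_num => //; exact: tensor_integrable.
rewrite -(fineK (fin_mu _ Ig)) -(fineK (fin_nu _ Ig)); congr EFin.
apply/eqP; rewrite -subr_eq0; apply/eqP.
have /LinfP[_ [M fM]] := If.
have h1fin : ('N[mu]_1[EFin \o h])%E \is a fin_num.
  rewrite Lnorm1 ge0_fin_numE ?integral_ge0//.
  by move/integrableP : h1 => [].
move: g Ig; apply: (@Linf_functional_eq0 _ _ _ _
    (fun g => \int[mu]_x (h x * g x) - \int[nu]_z (f z.1 * g z.2))
    (* For [g] bounded by one, the first summand bounds the integral over [mu], the second the one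
       over [nu]. *)
    (fine ('N[mu]_1[EFin \o h])%E + M * fine (nu setT))).
- move=> a g1 g2 I1 I2 /=.
  under [X in X - _ = _]eq_Rintegral do rewrite mulrDr mulrCA.
  under [X in _ - X = _]eq_Rintegral do rewrite mulrDr mulrCA.
  have imu g' : Linf mu g' -> mu.-integrable setT (EFin \o (fun x => h x * g' x)).
    by move=> ?; exact: L1_mulr_integrable.
  have inu g' : Linf mu g' ->
      nu.-integrable setT (EFin \o (fun z => f z.1 * g' z.2)).
    by move=> ?; exact: tensor_integrable.
  rewrite !RintegralD//; try exact: imu; try exact: inu.
  - rewrite !RintegralZl//; [ring|exact: inu|exact: imu].
  - exact: (integrableZl measurableT a (inu _ I1)).
  - exact: (integrableZl measurableT a (imu _ I1)).
- move=> g N Ig gN; rewrite (le_trans (ler_normB _ _))// mulrDl lerD//.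
  + have [_] := L1_mulr h1 Ig gN.
    rewrite -(fineK (fin_mu _ Ig)) -(fineK h1fin) -EFinM abse_EFin lee_fin.
    done.
  + have [_] := tensor_le If Ig fM gN.
    rewrite -(fineK (fin_nu _ Ig)) abse_EFin lee_fin.
    by move=> /le_trans; apply; rewrite mulrAC.
- by move=> E mE; rewrite /Rintegral hE// subrr.
Qed.


Lemma P_operator_pair_le (A : (T -> R) -> (T -> R)) : P_operator mu A ->
  exists C, forall f g M N, Linf mu f -> Linf mu g ->
    (\forall x \ae mu, `|f x| <= M) -> (\forall x \ae mu, `|g x| <= N) ->
    (`|pairA mu A f g| <= (C * M * N)%:E)%E.
Proof.
(* [P_operator] does not state [0 <= C]; the absolute value makes multiplication by the constant
   monotone. *)
move=> [A1 _ _ [C AC]]; exists `|C| => f g M N If Ig fM gN.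
have [_ /le_trans] := L1_mulr (A1 f If) Ig gN; apply.
rewrite EFinM lee_wpmul2r ?lee_fin ?(ae_bound_ge0 gN)//.
apply: le_trans (AC f If) _; rewrite EFinM.
apply: (@le_trans _ _ (`|C|%:E * 'N[mu]_(+oo%E)[EFin \o f])%E).
  by rewrite lee_wpmul2r ?Lnorm_ge0// lee_fin ler_norm.
by rewrite lee_wpmul2l ?lee_fin//; exact/Lnorm_oo_leP.
Qed.

(** Counterpart in the first variable: boundedness comes from [P_operator_pair_le], and the
    linearity of [A], valid almost everywhere, is used under the integral. *)
Lemma eq_tensor_fst (A : (T -> R) -> (T -> R)) g : P_operator mu A ->
  Linf mu g ->
  (forall E, measurable E ->
    pairA mu A \1_E g = \int[nu]_z (\1_E z.1 * g z.2)%:E)%E ->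
  forall f, Linf mu f ->
    (pairA mu A f g = \int[nu]_z (f z.1 * g z.2)%:E)%E.
Proof.
move=> PA Ig hE f If; have [C AC] := P_operator_pair_le PA.
have [A1 Aae Alin _] := PA.
have fin_mu f' : Linf mu f' -> pairA mu A f' g \is a fin_num.
  move=> If'; apply: integrable_fin_num => //.
  by apply: L1_mulr_integrable => //; exact: A1.
have fin_nu f' : Linf mu f' ->
    (\int[nu]_z (f' z.1 * g z.2)%:E)%E \is a fin_num.
  by move=> If'; apply: integrable_fin_num => //; exact: tensor_integrable.
rewrite -(fineK (fin_mu _ If)) -(fineK (fin_nu _ If)); congr EFin.
apply/eqP; rewrite -subr_eq0; apply/eqP.
have /LinfP[_ [N gN]] := Ig.
move: f If; apply: (@Linf_functional_eq0 _ _ _ _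
    (fun f => fine (pairA mu A f g) - \int[nu]_z (f z.1 * g z.2))
    (C * N + N * fine (nu setT))).
- move=> a f1 f2 I1 I2 /=.
  have imu f' : Linf mu f' -> mu.-integrable setT (EFin \o (fun x => A f' x * g x)).
    by move=> ?; apply: L1_mulr_integrable => //; exact: A1.
  have inu f' : Linf mu f' ->
      nu.-integrable setT (EFin \o (fun z => f' z.1 * g z.2)).
    by move=> ?; exact: tensor_integrable.
  have -> : fine (pairA mu A (fun x => a * f1 x + f2 x) g) =
      \int[mu]_x (a * (A f1 x * g x) + A f2 x * g x).
    congr fine; apply: ae_eq_integral => //.
    + exact: measurable_int (imu _ (Linf_lin a I1 I2)).
    + by apply/measurable_EFinP; apply: measurable_funD;
        [apply: measurable_funM => //|];
        apply/measurable_EFinP; apply: measurable_int (imu _ _).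
    + apply: filterS (Alin a _ _ I1 I2) => x /(_ I) -> _.
      by rewrite mulrDl mulrA.
  under [X in _ - X = _]eq_Rintegral do rewrite mulrDl -mulrA.
  rewrite !RintegralD//; try exact: imu; try exact: inu.
  - rewrite !RintegralZl//; [|exact: inu|exact: imu].
    by rewrite /Rintegral /pairA; ring.
  - exact: (integrableZl measurableT a (inu _ I1)).
  - exact: (integrableZl measurableT a (imu _ I1)).
- move=> f M If fM; rewrite (le_trans (ler_normB _ _))// mulrDl lerD//.
  + have := AC f g M N If Ig fM gN.
    rewrite -(fineK (fin_mu _ If)) abse_EFin lee_fin.
    by move=> /le_trans; apply; rewrite mulrAC.
  + have [_] := tensor_le If Ig fM gN.
    rewrite -(fineK (fin_nu _ If)) abse_EFin lee_fin.
    by move=> /le_trans; apply; rewrite -mulrA mulrC.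
- by move=> E mE; rewrite hE// subrr.
Qed.

(** Equality is extended one variable at a time: first to all [g] with [f] an indicator, then to all
    [f]. *)
Lemma represents_rectangles (A : (T -> R) -> (T -> R)) : P_operator mu A ->
  (forall S U, measurable S -> measurable U ->
    pairA mu A \1_S \1_U = nu (S `*` U)) ->
  represents mu A nu.
Proof.
move=> PA hSU f g If Ig; have [A1 _ _ _] := PA.
apply: eq_tensor_fst => // S mS; move: g Ig; apply: eq_tensor_snd.
- exact: Linf_indic.
- by apply: A1; exact: Linf_indic.
- by move=> U mU; rewrite tensor_indic// -hSU.
Qed.

(* Radon-Nikodym for the charge [E |-> \int_(z.2 \in E) f z.1 dnu]. *)
Lemma tensor_density f : Linf mu f -> exists2 h, L1 mu h &
  forall g, Linf mu g ->
    (\int[mu]_x (h x * g x)%:E = \int[nu]_z (f z.1 * g z.2)%:E)%E.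
Proof.
move=> If.
have int_f : nu.-integrable setT (fun z => (f z.1)%:E).
  have := tensor_integrable If (Linf_indic mu measurableT).
  by apply: eq_integrable => // z _; rewrite /= indicT mulr1.
pose rho : {charge set T -> \bar R} :=
  image_charge (induced_charge int_f) measurable_snd.
have rho_mu : rho `<< mu.
  apply/null_content_dominatesP => E mE E0.
  rewrite /rho/= /image_charge /pushforward /induced_charge /=.
  rewrite null_set_integral//.
  - by rewrite -[X in measurable X]setTI; exact: measurable_snd.
  - apply: measurable_funTS; exact: measurable_int int_f.
  - exact: null_snd.
pose h x := fine ((Radon_Nikodym rho mu) x).
have hE : EFin \o h = (Radon_Nikodym rho mu).
  by apply/funext => x; rewrite /h /= fineK// Radon_Nikodym_fin_num.
have h1 : L1 mu h by rewrite /L1 hE; exact: Radon_Nikodym_integrable.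
exists h => //; apply: eq_tensor_snd => // E mE.
rewrite integral_mul_indic//.
transitivity (\int[mu]_(x in E) (EFin \o h) x)%E; first by [].
rewrite hE -Radon_Nikodym_integral// /rho/= /image_charge /pushforward.
rewrite /induced_charge [LHS]integral_mkcond; apply: eq_integral => z _.
rewrite patchE indicE (_ : (z \in snd @^-1` E) = (z.2 \in E)); last first.
  by apply/idP/idP => /set_mem ?; exact: mem_set.
by case: ifPn => _; rewrite ?mulr1// mulr0.
Qed.

(** * Graphops represented by a given measure *)

Section representing_family.
Variable A : (T -> R) -> (T -> R).
Hypothesis A1 : forall f, Linf mu f -> L1 mu (A f).
Hypothesis Anu : represents mu A nu.

(** [A f] is determined almost everywhere by its integrals over measurable sets, which [nu]
    computes; each axiom becomes a statement on integrals against [nu]. *)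
Lemma represents_graphop : graphop mu A.
Proof.
have test f E : Linf mu f -> measurable E -> (\int[mu]_x (A f x * \1_E x)%:E =
    \int[nu]_z (f z.1 * \1_E z.2)%:E)%E.
  by move=> If mE; apply: Anu => //; exact: Linf_indic.
split.
- split=> //.
  + move=> v w Iv Iw vw; apply: L1_ae_eq; [exact: A1..|] => E mE.
    rewrite !test//; apply: ae_eq_integral => //.
    * exact: measurable_int (tensor_integrable Iv (Linf_indic mu mE)).
    * exact: measurable_int (tensor_integrable Iw (Linf_indic mu mE)).
    * have /ae_fst : \forall x \ae mu, [set x | v x = w x] x.
        by apply: filterS vw => x; exact.
      by apply: filterS => z /= -> _.
  + move=> a v w Iv Iw; apply: L1_ae_eq.
    * by apply: A1; exact: Linf_lin.
    * have := A1 Iw; have := integrableZl measurableT a (A1 Iv).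
      exact: integrableD.
    * move=> E mE; have IE := Linf_indic mu mE.
      have IAv := L1_mulr_integrable (A1 Iv) IE.
      have IAw := L1_mulr_integrable (A1 Iw) IE.
      have Ivnu := tensor_integrable Iv IE.
      have Iwnu := tensor_integrable Iw IE.
      rewrite test//; last exact: Linf_lin.
      under eq_integral do rewrite mulrDl -mulrA EFinD EFinM.
      under [RHS]eq_integral do rewrite mulrDl -mulrA EFinD EFinM.
      rewrite !integralD//; try exact: integrableZl.
      by rewrite !integralZl// !test.
  + exists (fine (nu setT)) => v Iv.
    (* The sign of [A v], with value 1 at zero: pairing [A v] with it gives the L^1 norm. *)
    pose s x : R := 2 * \1_[set x | 0 <= A v x] x + (- \1_setT x).
    have mE : measurable [set x | 0 <= A v x].
      rewrite -[X in measurable X]setTI -preimage_itvcy.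
      have : measurable_fun setT (A v).
        by apply/measurable_EFinP; exact: measurable_int (A1 Iv).
      exact.
    have sE x : s x = if 0 <= A v x then 1 else -1.
      rewrite /s indicT indicE; case: ifPn => h; [rewrite mem_set//|rewrite memNset/=].
      + by rewrite /=; ring.
      + by rewrite /=; ring.
      + by apply/negP.
    have Is : Linf mu s.
      have -> : s = fun x => 2 * \1_[set x | 0 <= A v x] x + (-1 * \1_setT x + 0).
        by apply/funext => x; rewrite /s mulN1r addr0.
      apply: Linf_lin; first exact: Linf_indic.
      apply: Linf_lin; first exact: Linf_indic.
      have -> : (fun=> 0 : R) = \1_(set0 : set T).
        by apply/funext => x; rewrite indic0.
      exact: Linf_indic.
    have s1 : \forall x \ae mu, `|s x| <= 1.
      by apply: aeW => x; rewrite sE; case: ifP; rewrite ?normrN normr1.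
    have [_ Voo] := Iv.
    have Vfin : ('N[mu]_(+oo%E)[EFin \o v])%E \is a fin_num.
      by rewrite ge0_fin_numE// Lnorm_ge0.
    have /Lnorm_oo_leP vM : ('N[mu]_(+oo%E)[EFin \o v] <=
       (fine ('N[mu]_(+oo%E)[EFin \o v])%E)%:E)%E by rewrite fineK.
    have [_] := tensor_le Iv Is vM s1.
    rewrite -Anu// Lnorm1 mulr1 [_ * fine (nu _)]mulrC EFinM !fineK ?fin_num_measure//.
    move=> h; apply: le_trans h; rewrite /pairA (le_trans _ (lee_abs _))//.
    rewrite le_eqVlt; apply/orP; left; apply/eqP; apply: eq_integral => x _ /=.
    by rewrite sE; case: leP => h; [rewrite mulr1 ger0_norm|rewrite mulrN1 ltr0_norm].
- by move=> v w Iv Iw; rewrite !Anu// tensor_swap.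
- move=> v Iv v0; apply: L1_ge0; first exact: A1.
  move=> E mE; rewrite test//.
  (* [v] is nonnegative only almost everywhere; [|v|] makes the integrand nonnegative at every
     point. *)
  rewrite (ae_eq_integral (fun z => (`|v z.1| * \1_E z.2)%:E))//.
  + by apply: integral_ge0 => z _; rewrite lee_fin mulr_ge0.
  + exact: measurable_int (tensor_integrable Iv (Linf_indic mu mE)).
  + apply/measurable_EFinP; apply: (@measurable_tensor (fun x => `|v x|)).
      by apply: measurableT_comp => //; case: Iv.
    exact: measurable_indic.
  + have := ae_fst v0; apply: filterS => z /= v0z _.
    by rewrite ger0_norm.
Qed.

End representing_family.

Lemma graphop_of_measure : exists A : (T -> R) -> (T -> R),
  [/\ graphop mu A, represents mu A nu
    & forall A' : (T -> R) -> (T -> R), graphop mu A' -> represents mu A' nu ->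
        forall f, Linf mu f -> ae_eq mu setT (A' f) (A f)].
Proof.
have /choice[A AP] : forall f : T -> R, exists h : T -> R, Linf mu f ->
    L1 mu h /\ forall g, Linf mu g ->
    (\int[mu]_x (h x * g x)%:E = \int[nu]_z (f z.1 * g z.2)%:E)%E.
  (* Outside L^oo any value would do; [f] is a placeholder. *)
  move=> f; have [If|nIf] := pselect (Linf mu f); last by exists f.
  by have [h h1 hP] := tensor_density If; exists h.
have A1 f : Linf mu f -> L1 mu (A f) by move=> /AP[].
have Anu : represents mu A nu by move=> f g If Ig; have [_] := AP _ If; exact.
exists A; split => //; first exact: represents_graphop.
move=> A' [[A'1 _ _ _] _ _] A'nu f If.
apply: L1_ae_eq; [exact: A'1|exact: A1|] => E mE.
by have IE := Linf_indic mu mE; rewrite [LHS]A'nu// [RHS]Anu.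
Qed.

End symmetric_measure.

(** * Construction of a measure from its conditional distributions *)

Section density_measure.
Context d (T : measurableType d) (R : realType).
Variables (m : {measure set T -> \bar R}) (f : T -> R).
Hypotheses (mf : measurable_fun setT f) (f0 : forall x, 0 <= f x).

(** As for [image_measure], the proofs are arguments so that the measure structure can be
    inferred. *)
Definition density_measure of measurable_fun setT f & (forall x, 0 <= f x) :
  set T -> \bar R := fun E => (\int[m]_(x in E) (f x)%:E)%E.

Let nu := density_measure mf f0.
Let nu0 : nu set0 = 0%E. Proof. exact: integral_set0. Qed.
Let nu_ge0 E : (0 <= nu E)%E.
Proof. by apply: integral_ge0 => x _; rewrite lee_fin. Qed.
Let nu_sigma_additive : semi_sigma_additive nu.
Proof. by apply: semi_sigma_additive_nng_induced => //; exact/measurable_EFinP. Qed.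

HB.instance Definition _ := isMeasure.Build _ _ _
  (density_measure mf f0) nu0 nu_ge0 nu_sigma_additive.

End density_measure.

(* [P S] stands for the density of [U |-> nu (S `*` U)] with respect to [mu].
   Standard Borel spaces enter through the retraction [(phi, psi)], which gives
   the conditional distribution functions [F q x]; on the part of [T * R] below
   these, [nu] is the image of [mu \x lebesgue_measure] under the conditional
   quantile function [Q]. *)
Section symmetric_family.
Context d (T : measurableType d) (R : realType) (mu : probability T R).
Variable P : set T -> T -> R.
Hypothesis mP : forall S, measurable S -> measurable_fun setT (P S).
Hypothesis P_ge0 : forall S x, 0 <= P S x.
Hypothesis P_sym : forall S U, measurable S -> measurable U ->
  (\int[mu]_(x in U) (P S x)%:E = \int[mu]_(x in S) (P U x)%:E)%E.
Hypothesis P_le : forall S S', measurable S -> measurable S' -> S `<=` S' ->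
  \forall x \ae mu, P S x <= P S' x.
Hypothesis P_fin : (\int[mu]_x (P setT x)%:E < +oo)%E.
Variables (phi : T -> measurableTypeR R) (psi : measurableTypeR R -> T).
Hypotheses (mphi : measurable_fun setT phi) (mpsi : measurable_fun setT psi).
Hypotheses (phi_gt0 : forall x, 0 < phi x) (phiK : cancel phi psi).

Let level (r : R) : set T := phi @^-1` `]-oo, r[.

Let mlevel r : measurable (level r).
Proof. by rewrite -[level r]setTI; exact: mphi. Qed.

Let level_le r s : r <= s -> level r `<=` level s.
Proof. by move=> rs x; rewrite /level /= !in_itv/= => /lt_le_trans; exact. Qed.

Let F (q : rat) : T -> R := P (level `|ratr q|).

Let sub (q : rat) : set (T * measurableTypeR R) := [set z | z.2 <= F q z.1].

Let msub q : measurable (sub q).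
Proof.
have mf : measurable_fun setT (fun z : T * measurableTypeR R => z.2 <= F q z.1).
  apply: measurable_fun_ler; first exact: measurable_snd.
  by apply: measurableT_comp; [exact: mP|exact: measurable_fst].
by have := mf measurableT [set true] I; rewrite setTI; congr measurable.
Qed.

(** The [F q] increase with [|q|] only almost everywhere; the union over [q] avoids correcting them
    on null sets. *)
Let region (U : set T) (I : set rat) : set (T * measurableTypeR R) :=
  U `*` `]0, +oo[ `&` \bigcup_(q in I) sub q.

Let mregion U I : measurable U -> measurable (region U I).
Proof.
move=> mU; apply: measurableI; first exact: measurableX.
rewrite bigcup_mkcond; apply: bigcupT_measurable_rat => q.
by case: ifPn.
Qed.

Let prod : {measure set (T * measurableTypeR R) -> \bar R} := (mu \x lebesgue_measure)%E.

Let lebesgue_itv (a : R) : 0 <= a -> lebesgue_measure `]0, a] = a%:E.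
Proof.
move=> a0; rewrite lebesgue_measure_itv/= lte_fin; case: ltP => h.
  by rewrite oppr0 adde0.
by congr EFin; apply/eqP; rewrite eq_le a0.
Qed.

Let mPU S U : measurable S -> measurable U ->
  measurable_fun setT ((fun x => (P S x)%:E) \_ U).
Proof.
move=> mS mU; apply/(measurable_restrictT _ mU)/measurable_EFinP.
by apply: measurable_funTS; exact: mP.
Qed.

(* For a.e. [x] in [U], the section of [region U I] at [x] lies in
   [`]0, P S x]]. *)
Let region_le U I S : measurable U -> measurable S ->
  (forall q, I q -> level `|ratr q| `<=` S) ->
  (prod (region U I) <= \int[mu]_(x in U) (P S x)%:E)%E.
Proof.
move=> mU mS IS; rewrite [leRHS]integral_mkcond.
have ae q : \forall x \ae mu, I q -> F q x <= P S x.
  have [Iq|nIq] := pselect (I q); last by apply: aeW => x /nIq.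
  by apply: filterS (P_le (mlevel _) mS (IS q Iq)) => x.
(* The rationals are enumerated by [unpickle], so that the exceptional null sets can be united. *)
have : \forall x \ae mu, forall n, if unpickle n is Some q then
    I q -> F q x <= P S x else True.
  by apply: ae_foralln => n; case: unpickle => //; exact: aeW.
move=> aeP; apply: ae_ge0_le_integral => //.
- apply: measurable_fun_xsection; exact: mregion.
- by move=> x _; rewrite patchE; case: ifP => // _; rewrite lee_fin.
- exact: mPU.
apply: filterS aeP => x hx _; rewrite /= patchE; case: ifPn => xU.
  rewrite -[leRHS](lebesgue_itv (P_ge0 S x)).
  apply: le_measure; rewrite ?inE//.
    by apply: measurable_xsection; exact: mregion.
  move=> t; rewrite /xsection /= inE => -[[_ /=]]; rewrite in_itv/= andbT => t0.
  move=> [q Iq]; rewrite /sub /= => tF; rewrite in_itv/= t0/=.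
  by apply: (le_trans tF); have := hx (pickle q); rewrite pickleK; exact.
rewrite (_ : xsection _ _ = set0) ?measure0//.
apply/seteqP; split => // t; rewrite /xsection /= inE => -[[/= xU' _] _].
by move/negP : xU; apply; exact: mem_set.
Qed.

(** Every section at a point [x] of [U] contains []0, F q x]], whose length is [F q x]. *)
Let region_ge U (I : set rat) q : measurable U -> I q ->
  (\int[mu]_(x in U) (F q x)%:E <= prod (region U I))%E.
Proof.
move=> mU Iq; rewrite integral_mkcond; apply: ge0_le_integral => //.
- by move=> x _; rewrite patchE; case: ifP => // _; rewrite lee_fin P_ge0.
- exact: mPU.
- apply: measurable_fun_xsection; exact: mregion.
move=> x _; rewrite /= patchE; case: ifPn => xU; last exact: measure_ge0.
rewrite -[leLHS](lebesgue_itv (P_ge0 _ x)).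
apply: le_measure; rewrite ?inE//.
  by apply: measurable_xsection; exact: mregion.
move=> t; rewrite /= in_itv/= => /andP[t0 tF].
rewrite /xsection /= inE; split; last by exists q.
by split; [exact: set_mem|rewrite /= in_itv/= t0].
Qed.

(* The rationals enter through their absolute values so that the infimum is
   over a set bounded below; over the empty set [inf] is [0]. *)
Let Q (z : T * R) : R := inf [set `|ratr q| | q in [set q : rat | sub q z]].

Let Q_lt z r : (exists q, sub q z) ->
  Q z < r <-> exists2 q : rat, `|ratr q| < r & sub q z.
Proof.
move=> [q0 q0z]; split => [/inf_lt[|y [q qz <-] qr]|[q qr qz]].
- by exists `|ratr q0|; exists q0.
- by exists q.
apply: le_lt_trans qr; apply: ge_inf; last by exists q.
by exists 0 => _ [s _ <-].
Qed.

Let mQ : @measurable_fun _ _ (T * measurableTypeR R)%type (measurableTypeR R) setT Q.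
Proof.
apply: (measurability _ (RGenInftyO.measurableE R)) => _ [_ [r ->] <-].
rewrite setTI.
(* Points in no [sub q] have [Q z = 0], so they belong to the preimage exactly when [0 < r]. *)
have -> : Q @^-1` `]-oo, r[ = \bigcup_(q in [set q : rat | `|ratr q| < r]) sub q
    `|` (if 0 < r then ~` \bigcup_q sub q else set0).
  apply/seteqP; split=> z /=; rewrite in_itv/=.
  - have [ez /(Q_lt _ ez)[q qr qz]|nez] := pselect (exists q, sub q z).
      by left; exists q.
    rewrite /Q (_ : [set _ | _ in _] = set0) ?inf0; last first.
      by apply/seteqP; split => // y [q qz _]; apply: nez; exists q.
    by move=> r0; right; rewrite r0 => -[q _ qz]; apply: nez; exists q.
  - move=> [[q qr qz]|]; first by apply/Q_lt; exists q.
    case: ifP => // r0 nez; rewrite /Q (_ : [set _ | _ in _] = set0) ?inf0//.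
    by apply/seteqP; split => // y [q qz _]; apply: nez; exists q.
apply: measurableU.
  rewrite bigcup_mkcond; apply: bigcupT_measurable_rat => q.
  by case: ifPn.
by case: ifP => // _; apply: measurableC; exact: bigcupT_measurable_rat.
Qed.

(** The law of [Q] on the region over [U]. It is to coincide with [pdens], the law of [phi] under
    the density [P U]: at [E], both are to be [nu] of the product of the preimage of [E] under [phi]
    with [U]. *)
Let pmeas U (mU : measurable U) : {measure set (measurableTypeR R) -> \bar R} :=
  image_measure (mrestr prod (mregion setT mU)) mQ.

Let pmeasE U (mU : measurable U) (r : R) :
  pmeas mU `]-oo, r[%classic = prod (region U [set q : rat | `|ratr q| < r]).
Proof.
rewrite /pmeas /= /image_measure /pushforward /mrestr; congr (prod _).
apply/seteqP; split => z /=.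
  rewrite in_itv/= => -[zr [Uz [q _ qz]]]; split => //.
  by apply/Q_lt => //; exists q.
move=> [Uz [q qr qz]]; rewrite in_itv/=; split; last by split => //; exists q.
by apply/Q_lt; exists q.
Qed.

Let dens U (mU : measurable U) : {measure set T -> \bar R} :=
  density_measure mu (mP mU) (P_ge0 U).

Let pdens U (mU : measurable U) : {measure set (measurableTypeR R) -> \bar R} :=
  image_measure (dens mU) mphi.

(** Upper bound: [region_le] with [S = level r]. Lower bound: [region_ge] at a rational between [s]
    and [r], then [s] tends to [r] from below. [P_sym] moves the integral from [U] to the level
    set. *)
Let pmeas_dens_itv U (mU : measurable U) (r : R) :
  pmeas mU `]-oo, r[%classic = pdens mU `]-oo, r[%classic.
Proof.
rewrite pmeasE /pdens/= /image_measure /pushforward -/(level r).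
rewrite /dens/= /density_measure.
have bound s : s < r -> (\int[mu]_(x in level s) (P U x)%:E <=
    prod (region U [set q : rat | (`|ratr q| < r)%R]))%E.
  (* As [phi] is positive, [level s] is empty for [s <= 0]; otherwise the rational chosen is
     positive and equals its absolute value. *)
  move=> sr; have [s0|s0] := leP s 0.
    rewrite (_ : level s = set0) ?integral_set0 ?measure_ge0//.
    apply/seteqP; split => // x; rewrite /level /= in_itv/= => /lt_le_trans.
    by move=> /(_ _ s0); rewrite ltNge ltW.
  have [q] := rat_in_itvoo sr; rewrite in_itv/= => /andP[sq qr].
  have q0 : (0 : R) < ratr q by exact: lt_trans sq.
  have Iq : [set q : rat | `|ratr q| < r] q by rewrite /= gtr0_norm.
  apply: le_trans (region_ge mU Iq).
  rewrite /F [leRHS]P_sym//; apply: ge0_subset_integral => //.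
  - by apply/measurable_EFinP; apply: measurable_funTS; exact: mP.
  - by move=> x _; rewrite lee_fin.
  - by apply: level_le; rewrite gtr0_norm// ltW.
apply/eqP; rewrite eq_le; apply/andP; split.
  rewrite -P_sym//; apply: region_le => // q /= qr.
  by apply: level_le; exact: ltW.
pose L (k : nat) := level (r - k.+1%:R^-1).
have LE : \bigcup_k L k = level r.
  apply/seteqP; split => [x [k _]|x].
    by apply: level_le; rewrite lerBlDr lerDl.
  rewrite /level /= in_itv/= => /ltr_add_invr[k xk]; exists k => //.
  by rewrite /L /level /= in_itv/= ltrBrDr.
have ndL : nondecreasing_seq L.
  move=> i j ij; apply/subsetPset; apply: level_le.
  by rewrite lerB// lef_pV2 ?posrE// ler_nat.
have := @nondecreasing_cvg_mu _ _ _ (dens mU) L (fun=> mlevel _) _ ndL.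
rewrite LE => /(_ (mlevel r)) cvgL.
apply: (cvge_to_le cvgL); apply: nearW => k /=.
by apply: bound; rewrite ltrBlDr ltrDl.
Qed.

Let pmeas_dens U (mU : measurable U) E : measurable E ->
  pmeas mU E = pdens mU E.
Proof.
move: E; have h := @measure_unique _ R (measurableTypeR R) (@RGenInftyO.G R)
  (fun k => `]-oo, k%:R[%classic) (RGenInftyO.measurableE R) _ _ _
  (pmeas mU) (pdens mU).
apply: h.
- move=> _ _ [r ->] [s ->]; exists (Num.min r s).
  by apply/seteqP; split => x /=; rewrite !in_itv/= lt_min => /andP.
- by move=> k; exists k%:R.
- by apply/seteqP; split => // x _; exists (Num.truncn `|x|).+1 => //=;
    rewrite in_itv/= (le_lt_trans (ler_norm x))// truncnS_gt.
- by move=> _ [r ->]; exact: pmeas_dens_itv.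
move=> k; rewrite [ltLHS]pmeas_dens_itv /pdens/= /image_measure /pushforward.
apply: le_lt_trans P_fin; rewrite /dens/= /density_measure.
have mPE S : measurable S -> measurable_fun setT (fun x => (P S x)%:E).
  by move=> mS; apply/measurable_EFinP; exact: mP.
apply: (@le_trans _ _ (\int[mu]_x (P U x)%:E)%E).
  apply: ge0_subset_integral => //; [exact: mlevel|exact: mPE|].
  by move=> x _; rewrite lee_fin.
(* By symmetry the total mass is the integral of [P setT] over [U], which [P_fin] bounds. *)
rewrite P_sym//; apply: ge0_subset_integral => //; first exact: mPE.
by move=> x _; rewrite lee_fin.
Qed.

Let H (z : T * measurableTypeR R) : T * T := (psi (Q z), z.1).

Let mH : measurable_fun setT H.
Proof.
apply: measurable_fun_pair; last exact: measurable_fst.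
exact: measurableT_comp mpsi mQ.
Qed.

(** On the region over [U], [H] lands in the rectangle exactly when [Q] lies in the preimage of [S]
    by [psi]; [pmeas_dens] turns this into the integral of [P U] over the preimage of [S] by
    [psi \o phi], which is [S]. *)
Lemma measure_of_symmetric_family :
  exists nu : {finite_measure set (T * T)%type -> \bar R},
  forall S U, measurable S -> measurable U ->
    (nu (S `*` U) = \int[mu]_(x in U) (P S x)%:E)%E.
Proof.
pose m : {measure set (T * T)%type -> \bar R} :=
  image_measure (mrestr prod (mregion setT measurableT)) mH.
have mE S U : measurable S -> measurable U ->
    (m (S `*` U) = \int[mu]_(x in U) (P S x)%:E)%E.
  move=> mS mU; rewrite P_sym//.
  have mpsiS : measurable (psi @^-1` S).
    by rewrite -[_ @^-1` _]setTI; exact: mpsi.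
  have := pmeas_dens mU mpsiS.
  rewrite /pdens/= /image_measure /pushforward /dens/= /density_measure.
  rewrite (_ : phi @^-1` (psi @^-1` S) = S); last first.
    by apply/seteqP; split => x /=; rewrite phiK.
  move=> <-; rewrite /m /pmeas /= /image_measure /pushforward /mrestr.
  congr (prod _); apply/seteqP; split => z /=.
    by move=> [[Sz Uz] [[_ z0] Iz]].
  by move=> [Sz [[Uz z0] Iz]].
have moo : (m setT < +oo)%E by rewrite -setXTT mE.
(* Restriction to the whole space changes no value; it attaches the finiteness [moo] to [m]. *)
exists [the {finite_measure set (T * T)%type -> \bar R} of mfrestr measurableT moo].
by move=> S U mS mU; rewrite /= /mfrestr /mrestr setIT mE.
Qed.

End symmetric_family.

(** * Standard Borel spaces and the measure of a graphop *)

Lemma standard_borel_retract d (T : measurableType d) (R : realType) (t0 : T) :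
  standard_borel T R ->
  exists (phi : T -> measurableTypeR R) (psi : measurableTypeR R -> T),
    [/\ measurable_fun setT phi, measurable_fun setT psi,
        forall x, 0 < phi x :> R & cancel phi psi].
Proof.
move=> [B [phi [mB mphi phi_inj phiB mphi_im]]].
pose psi (y : measurableTypeR R) : T := xget t0 [set x | phi x = y].
have phiK : cancel phi psi.
  by move=> x; rewrite /psi; case: xgetP => [y _ /phi_inj//|/(_ x)[]].
have mpsi : measurable_fun setT psi.
  move=> _ E mE; rewrite setTI.
  (* On [B], [psi] inverts [phi]; off [B] it takes the default value [t0]. *)
  have -> : psi @^-1` E = phi @` E `|` (if t0 \in E then ~` B else set0).
    apply/seteqP; split => y /=.
      rewrite /psi; case: xgetP => [x _ /= <- Ex|nx t0E]; first by left; exists x.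
      right; rewrite mem_set//= -phiB => -[x _ xy]; exact: (nx x).
    move=> [[x Ex <-]|]; first by rewrite phiK.
    case: ifPn => // /set_mem t0E nBy; rewrite /psi; case: xgetP => [x _ xy|//].
    by exfalso; apply: nBy; rewrite -phiB; exists x.
  apply: measurableU; first exact: mphi_im.
  by case: ifP => // _; exact: measurableC.
(* The exponential makes [phi] positive, and [ln] undoes it. *)
exists (expR \o phi), (psi \o @ln R); split.
- by apply: measurableT_comp mphi; exact: measurable_expR.
- by apply: measurableT_comp mpsi _; exact: measurable_ln.
- by move=> x; exact: expR_gt0.
- by move=> x; rewrite /= expRK phiK.
Qed.

Lemma measure_of_graphop d (T : measurableType d) (R : realType)
    (mu : probability T R) (A : (T -> R) -> (T -> R)) :
  standard_borel T R -> graphop mu A ->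
  exists nu : {finite_measure set (T * T)%type -> \bar R},
    [/\ symmetric_measure nu, marginal_ac mu nu, represents mu A nu
      & forall nu' : {finite_measure set (T * T)%type -> \bar R},
          symmetric_measure nu' -> marginal_ac mu nu' -> represents mu A nu' ->
          forall E : set (T * T)%type, measurable E -> nu' E = nu E].
Proof.
move=> sT gA; have [PA Asym Apos] := gA; have [A1 Aae Alin _] := PA.
have [t0 _] : [set: T] !=set0.
  apply/set0P/eqP => T0; have := probability_setT mu.
  by rewrite T0 measure0 => /eqP; rewrite eq_sym onee_eq0.
have [phi [psi [mphi mpsi phi0 phiK]]] := standard_borel_retract t0 sT.
(* [A \1_S] is nonnegative only almost everywhere; truncation gives a version that is so at every
   point. *)
pose P S x := Num.max (A \1_S x) 0.
have mA S : measurable S -> measurable_fun setT (A \1_S).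
  move=> mS; apply/measurable_EFinP.
  by apply: measurable_int (A1 _ _); exact: Linf_indic.
have mP S : measurable S -> measurable_fun setT (P S).
  by move=> mS; apply: measurable_maxr => //; exact: mA.
have P_ge0 S x : 0 <= P S x by rewrite /P le_max lexx orbT.
have PE S : measurable S -> \forall x \ae mu, P S x = A \1_S x.
  move=> mS; have : \forall x \ae mu, 0 <= A \1_S x.
    by apply: Apos; [exact: Linf_indic|exact: aeW].
  by apply: filterS => x h; rewrite /P max_l.
have pairE S U : measurable S -> measurable U ->
    (pairA mu A \1_S \1_U = \int[mu]_(x in U) (P S x)%:E)%E.
  move=> mS mU; rewrite /pairA integral_mul_indic//.
  apply: ae_eq_integral => //.
  - by apply/measurable_EFinP; apply: measurable_funTS; exact: mA.
  - by apply/measurable_EFinP; apply: measurable_funTS; exact: mP.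
  - by apply: filterS (PE S mS) => x -> _.
have P_sym S U : measurable S -> measurable U ->
    (\int[mu]_(x in U) (P S x)%:E = \int[mu]_(x in S) (P U x)%:E)%E.
  by move=> mS mU; rewrite -!pairE// Asym//; exact: Linf_indic.
have P_le S S' : measurable S -> measurable S' -> S `<=` S' ->
    \forall x \ae mu, P S x <= P S' x.
  move=> mS mS' SS'.
  have I1 := Linf_indic mu mS; have I2 := Linf_indic mu mS'.
  (* Monotonicity comes from the positivity of [A] on [\1_S' - \1_S]. *)
  have AD : \forall x \ae mu, 0 <= A (fun x => -1 * \1_S x + \1_S' x) x.
    apply: Apos; first exact: Linf_lin.
    apply: aeW => x; rewrite !indicE mulN1r addrC subr_ge0 ler_nat.
    have [xS|//] := boolP (x \in S); rewrite mem_set//.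
    by apply: SS'; exact: set_mem.
  have ASS' : \forall x \ae mu, A \1_S x <= A \1_S' x.
    apply: filterS2 AD (Alin (-1) _ _ I1 I2) => x AD /(_ I) AE.
    by rewrite -subr_ge0 addrC -mulN1r -[leRHS]AE.
  by move: (PE _ mS) (PE _ mS') ASS'; apply: filterS3 => x -> ->.
have P_fin : (\int[mu]_x (P setT x)%:E < +oo)%E.
  rewrite -pairE// ltey_eq (integrable_fin_num _ _)//.
  by apply: L1_mulr_integrable; [apply: A1|]; exact: Linf_indic.
have [nu nuE] := measure_of_symmetric_family mP P_ge0 P_sym P_le P_fin
  mphi mpsi phi0 phiK.
have nu_sym : symmetric_measure nu by move=> S U mS mU; rewrite !nuE// P_sym.
have nu_ac : marginal_ac mu nu.
  (* By symmetry the marginal has density [P setT]. *)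
  apply/null_content_dominatesP => S mS S0.
  rewrite /pushforward -setXT nuE// P_sym// null_set_integral//.
  by apply/measurable_EFinP; apply: measurable_funTS; exact: mP.
exists nu; split => //.
  by apply: represents_rectangles => // S U mS mU; rewrite nuE// pairE.
(* Tested on indicators, the representation fixes [nu'] on rectangles. *)
move=> nu' _ _ Anu' E mE; apply: measure_rectangles_unique mE.
  by rewrite -ge0_fin_numE// fin_num_measure.
move=> S U mS mU; rewrite [RHS]nuE// -pairE// Anu' ?tensor_indic//;
  exact: Linf_indic.
Qed.

Theorem theorem6p3 (d : measure_display) (T : measurableType d) (R : realType)
    (mu : probability T R) :
  standard_borel T R ->
  (forall A : (T -> R) -> (T -> R), graphop mu A ->
     exists nu : {finite_measure set (T * T)%type -> \bar R},
       [/\ symmetric_measure nu, marginal_ac mu nu, represents mu A nu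
         & forall nu' : {finite_measure set (T * T)%type -> \bar R},
             symmetric_measure nu' -> marginal_ac mu nu' -> represents mu A nu' ->
             forall E : set (T * T)%type, measurable E -> nu' E = nu E])
  /\
  (forall nu : {finite_measure set (T * T)%type -> \bar R},
     symmetric_measure nu -> marginal_ac mu nu ->
     exists A : (T -> R) -> (T -> R),
       [/\ graphop mu A, represents mu A nu
         & forall A' : (T -> R) -> (T -> R), graphop mu A' -> represents mu A' nu ->
             forall f : T -> R, Linf mu f -> ae_eq mu setT (A' f) (A f)]).
Proof.
move=> sT; split=> [A gA|nu nu_sym nu_ac]; first exact: measure_of_graphop.
exact: graphop_of_measure.
Qed.
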